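(* Let $k\ge1$ and let $\lambda_1,\dots,\lambda_k$ be positive constants. For $m,l,n\ge1$ let $p^{(n)}_{m,l,j}\in(0,1)$, $j=1,\dots,k$, be such that $\sum_{j=1}^kp^{(n)}_{m,l,j}<1$. Let $\{X^{(n)}_{m,l}\}_{m,l,n\ge1}$ be random variables, independent across $m$, $l$ and $n$, such that $X^{(n)}_{m,l}=j$ with probability $p^{(n)}_{m,l,j}$ for $j\in\{1,\dots,k\}$ and $X^{(n)}_{m,l}=0$ with probability $1-\sum_{j=1}^kp^{(n)}_{m,l,j}$. For $n\ge1$ define $$Y^{(n)}(s,t)=\sum_{m=1}^{[ns]}\sum_{l=1}^{[nt]}X^{(n)}_{m,l},\quad (s,t)\in\mathbb{R}^2_+.$$ Suppose that, as $n\to\infty$, for every $j=1,\dots,k$, $\max_{1\le m,l\le n}p^{(n)}_{m,l,j}\to0$ and $$\sum_{m=1}^{[ns]}\sum_{l=1}^{[nt]}p^{(n)}_{m,l,j}\to\lambda_jst\quad\text{for all }(s,t)\in\mathbb{R}^2_+.$$ Then for any $r\ge1$ and any $(0,0)\prec(s_1,t_1)\preceq\dots\preceq(s_r,t_r)$, $$(Y^{(n)}(s_1,t_1),\dots,Y^{(n)}(s_r,t_r))\overset{d}{\to}(M(s_1,t_1),\dots,M(s_r,t_r))\quad\text{as }n\to\infty,$$ where $\{M(s,t),\ (s,t)\in\mathbb{R}^2_+\}\sim GPRF\{\lambda_j\}_{1\le j\le k}$ and $\overset{d}{\to}$ denotes convergence in distribution.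
   Context: $\mathbb{R}_+=[0,\infty)$; $[x]$ is the integer part of $x$ (empty sums are $0$); $(s,t)\preceq(s',t')$ means $s\le s'$ and $t\le t'$, and $(s,t)\prec(s',t')$ means $s<s'$ and $t<t'$. For a two parameter process $X$ and $(s,t)\preceq(s',t')$, the rectangular increment is $\Delta_{s,t}X(s',t')=X(s',t')-X(s',t)-X(s,t')+X(s,t)$. Two parameter generalized Poisson random field $\{M(s,t),\ (s,t)\in\mathbb{R}^2_+\}\sim GPRF\{\lambda_j\}_{1\le j\le k}$: a non-negative integer valued process with $M(0,t)=M(s,0)=0$ almost surely, with independent rectangular increments over disjoint rectangles $(s,s']\times(t,t']$, and with $$\Pr\{\Delta_{s,t}M(s',t')=n\}=\sum_{(n_1,\dots,n_k)\in\Theta(k,n)}\prod_{j=1}^{k}\frac{(\lambda_j(s'-s)(t'-t))^{n_j}}{n_j!}e^{-\lambda_j(s'-s)(t'-t)},\quad n\ge0,$$ where $\Theta(k,n)=\{(n_1,\dots,n_k)\in\mathbb{N}_0^k:\sum_{j=1}^kjn_j=n\}$. *)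

(* Defs.v *)
From HB Require Import structures.
From mathcomp Require Import all_boot all_order all_algebra finmap.
From mathcomp Require Import all_classical all_reals all_analysis.

Set Implicit Arguments.
Unset Strict Implicit.
Unset Printing Implicit Defensive.

Import Order.TTheory GRing.Theory Num.Theory.
Import numFieldNormedType.Exports.

Local Open Scope classical_set_scope.
Local Open Scope ring_scope.

Definition preceq (R : realType) (a b : R * R) : Prop :=
  a.1 <= b.1 /\ a.2 <= b.2.

Definition prec (R : realType) (a b : R * R) : Prop :=
  a.1 < b.1 /\ a.2 < b.2.

Definition rectangle (R : realType) (a b : R * R) : set (R * R) :=
  [set` `]a.1, b.1]] `*` [set` `]a.2, b.2]].

Definition mutually_independent (R : realType) (d : measure_display)
    (T : measurableType d) (P : probability T R) (I : choiceType)
    (D : set I) (X : I -> T -> R) : Prop :=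
  forall (J : {fset I}) (B : I -> set R),
    [set` J] `<=` D ->
    (forall i, i \in J -> measurable (B i)) ->
    P (\bigcap_(i in [set` J]) (X i @^-1` B i)) =
      (\prod_(i <- J) P (X i @^-1` B i))%E.

(* Convergence of expectations of bounded continuous functions. The limit may
   live on another probability space. *)
Definition cvg_in_distribution (R : realType) (E : topologicalType)
    (d : measure_display) (T : measurableType d) (P : probability T R)
    (d' : measure_display) (T' : measurableType d') (P' : probability T' R)
    (Y : nat -> T -> E) (Z : T' -> E) : Prop :=
  forall f : E -> R, continuous f -> (exists C : R, forall x, `|f x| <= C) ->
    ('E_P[f \o Y n] @[n --> \oo] --> 'E_P'[f \o Z])%E.

Definition increment (R : realType) (d : measure_display)
    (T : measurableType d) (P : probability T R)
    (M : R -> R -> {RV P >-> R}) (a b : R * R) (w : T) : R :=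
  M b.1 b.2 w - M b.1 a.2 w - M a.1 b.2 w + M a.1 a.2 w.

(* i : 'I_k stands for the index j = i.+1 in {1, ..., k}.
   Every component of a solution of \sum_j j * n_j = n is at most n, so nothing
   is lost by taking the components in 'I_n.+1. *)
Definition Theta (k n : nat) : {set {ffun 'I_k -> 'I_n.+1}} :=
  [set v : {ffun 'I_k -> 'I_n.+1} | (\sum_(i < k) i.+1 * v i)%N == n].

Definition gprf_pmf (R : realType) (k : nat) (lambda : 'I_k -> R)
    (a b : R * R) (n : nat) : R :=
  \sum_(v in Theta k n) \prod_(i < k)
    ((lambda i * (b.1 - a.1) * (b.2 - a.2)) ^+ v i / (v i)`!%:R
      * expR (- (lambda i * (b.1 - a.1) * (b.2 - a.2)))).

(* M is indexed by R x R, but only its values at non-negative times are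
   constrained or used. *)
Record is_GPRF (R : realType) (d : measure_display) (T : measurableType d)
    (P : probability T R) (k : nat) (lambda : 'I_k -> R)
    (M : R -> R -> {RV P >-> R}) : Prop := IsGPRF {
  gprf_nat : forall (s t : R) (w : T), 0 <= s -> 0 <= t -> M s t w \is a Num.nat;
  gprf_left : forall t : R, 0 <= t -> {ae P, forall w, M 0 t w = 0};
  gprf_bottom : forall s : R, 0 <= s -> {ae P, forall w, M s 0 w = 0};
  gprf_indep : forall (N : nat) (a b : 'I_N -> R * R),
    (forall i, preceq (0, 0) (a i) /\ preceq (a i) (b i)) ->
    trivIset setT (fun i => rectangle (a i) (b i)) ->
    mutually_independent P setT (fun i => increment M (a i) (b i));
  gprf_law : forall (a b : R * R) (n : nat),
    preceq (0, 0) a -> preceq a b ->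
    P [set w | increment M a b w = n%:R] = (gprf_pmf lambda a b n)%:E
}.

Definition Ysum (R : realType) (d : measure_display) (T : measurableType d)
    (P : probability T R) (X : nat -> nat -> nat -> {RV P >-> R})
    (n : nat) (s t : R) (w : T) : R :=
  \sum_(1 <= m < (Num.truncn (n%:R * s)).+1)
    \sum_(1 <= l < (Num.truncn (n%:R * t)).+1) X n m l w.

(* Main.v *)
Require Import Defs.
From HB Require Import structures.
From mathcomp Require Import all_boot all_order all_algebra finmap.
From mathcomp Require Import all_classical all_reals all_analysis.
From mathcomp Require Import measurable_realfun ring lra.

(** Cut the plane into the rectangles of the grid spanned by the coordinates of
    the points z_i. Both Y^(n)(z_i) and, almost surely, M(z_i) are the sum of
    the block sums, resp. increments, over the rectangles below z_i, so it is
    enough to treat the joint law of these blocks. Write q_n(v) for the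
    probability that the block sums are v. Redrawing one cell gives
      v_i q_n(v) = \sum_j j P_n(i, j) q_n(v - j e_i) + O(\sum_c (\sum_j p_c,j)^2),
    where P_n(i, j) is the sum of the p_c,j over the cells c of block i. The
    generalized Poisson weights satisfy the same recursion without error (Panjer
    recursion), so induction on v gives pointwise convergence of the joint laws.
    The mean of the block sums being bounded, no mass escapes, whence the
    convergence of expectations of bounded continuous functions.
    The error term vanishes because the sum condition alone bounds every cell
    probability by the mass of an arbitrarily thin strip. *)

Set Implicit Arguments.
Unset Strict Implicit.
Unset Printing Implicit Defensive.

Import Order.TTheory GRing.Theory Num.Theory.
Import numFieldNormedType.Exports.

Local Open Scope classical_set_scope.
Local Open Scope ring_scope.

(** * Block sums of finitely many independent cells *)

Section CellSums.
Variables (R : realFieldType) (C I : finType) (k : nat) (lab : C -> I).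
Variable p : C -> 'I_k -> R.

Definition cell_mass (c : C) : R := \sum_j p c j.

(** The law of one cell. The ordinal [a] is the value itself: [ord0] is the value 0 and
    [lift ord0 j] is the value [j.+1]. *)
Definition cell_pmf (c : C) (a : 'I_k.+1) : R :=
  if unlift ord0 a is Some j then p c j else 1 - cell_mass c.

Definition weight (x : {ffun C -> 'I_k.+1}) : R := \prod_c cell_pmf c (x c).

Definition set_cell (x : {ffun C -> 'I_k.+1}) c a : {ffun C -> 'I_k.+1} :=
  [ffun c' => if c' == c then a else x c'].

Definition block_sum (x : {ffun C -> 'I_k.+1}) : {ffun I -> nat} :=
  [ffun i => (\sum_(c | lab c == i) x c)%N].

Definition block_pmf (v : {ffun I -> nat}) : R :=
  \sum_(x | block_sum x == v) weight x.

Definition block_mass (i : I) (j : 'I_k) : R := \sum_(c | lab c == i) p c j.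

(** The vector v - m e_i. The subtraction truncates, so each use is guarded by [m <= v i]. *)
Definition lower (v : {ffun I -> nat}) (i : I) (m : nat) : {ffun I -> nat} :=
  [ffun i' => if i' == i then (v i' - m)%N else v i'].

Lemma cell_pmf0 c : cell_pmf c ord0 = 1 - cell_mass c.
Proof. by rewrite /cell_pmf unlift_none. Qed.

Lemma cell_pmfS c j : cell_pmf c (lift ord0 j) = p c j.
Proof. by rewrite /cell_pmf liftK. Qed.

Lemma sum_cell_pmf c : \sum_a cell_pmf c a = 1.
Proof.
rewrite big_ord_recl cell_pmf0.
under eq_bigr do rewrite cell_pmfS.
by rewrite subrK.
Qed.

Lemma sum_weight : \sum_x weight x = 1.
Proof.
rewrite /weight -(bigA_distr_bigA (fun c a => cell_pmf c a)) /=.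
by rewrite big1// => c _; exact: sum_cell_pmf.
Qed.

Lemma weight_set_cell x c a :
  weight x * cell_pmf c a = weight (set_cell x c a) * cell_pmf c (x c).
Proof.
rewrite /weight (bigD1 c)//= [in RHS](bigD1 c)//= ffunE eqxx.
rewrite [X in _ = _ * X * _](eq_bigr (fun c' => cell_pmf c' (x c'))); last first.
  by move=> c' /negbTE c'c; rewrite ffunE c'c.
ring.
Qed.

(* Redrawing one cell independently of the others preserves the law: swapping
   the old and the new value of the cell is a weight-preserving involution. *)
Lemma sum_weight_set_cell c (G : {ffun C -> 'I_k.+1} -> R) :
  \sum_x weight x * G x =
  \sum_x weight x * \sum_a cell_pmf c a * G (set_cell x c a).
Proof.
under [RHS]eq_bigr do rewrite big_distrr /=.
rewrite pair_big /=.
pose h (u : {ffun C -> 'I_k.+1} * 'I_k.+1) := (set_cell u.1 c u.2, u.1 c).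
have hK : involutive h.
  move=> [x a]; rewrite /h /= ffunE eqxx; congr (_, _); apply/ffunP => c'.
  by rewrite !ffunE; case: eqP => // ->.
rewrite (reindex_inj (inv_inj hK)) /=.
rewrite (eq_bigr (fun u => weight u.1 * G u.1 * cell_pmf c u.2)); last first.
  move=> [x a] _ /=.
  rewrite (congr1 fst (hK (x, a)) : set_cell (set_cell x c a) c _ = x).
  by rewrite mulrA -weight_set_cell; ring.
rewrite -(pair_big xpredT xpredT (fun x a => weight x * G x * cell_pmf c a)) /=.
by apply: eq_bigr => x _; rewrite -big_distrr /= sum_cell_pmf mulr1.
Qed.

Lemma block_sum_set_cell x c a i : (lab c == i) ->
  block_sum (set_cell x c a) i = (a + block_sum (set_cell x c ord0) i)%N.
Proof.
move=> ci; rewrite !ffunE (bigD1 c)//= [in RHS](bigD1 c)//= !ffunE eqxx add0n.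
by congr (_ + _)%N; apply: eq_bigr => c' /andP[_ /negbTE c'c]; rewrite !ffunE c'c.
Qed.

Lemma block_sum_set_cellN x c a i : (lab c != i) ->
  block_sum (set_cell x c a) i = block_sum x i.
Proof.
move=> ci; rewrite !ffunE; apply: eq_bigr => c' /eqP c'i.
by rewrite ffunE; case: eqP => // c'c; rewrite -c'i c'c eqxx in ci.
Qed.

(** Separates the new value [a] from the erased configuration, which no longer depends on [x c]. *)
Lemma block_sum_eq x c a (v : {ffun I -> nat}) :
  (block_sum (set_cell x c a) == v) =
  (a <= v (lab c))%N && (block_sum (set_cell x c ord0) == lower v (lab c) a).
Proof.
apply/eqP/andP => [<-|[av /eqP h]].
- rewrite (block_sum_set_cell _ _ (eqxx _)) leq_addr; split => //.
  apply/eqP/ffunP => i; rewrite [RHS]ffunE; case: eqP => [->|/eqP ci].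
    by rewrite [in RHS](block_sum_set_cell _ _ (eqxx _)) addKn.
  by rewrite eq_sym in ci; rewrite !block_sum_set_cellN.
- apply/ffunP => i; case: (eqVneq i (lab c)) => [->|ci].
    by rewrite (block_sum_set_cell _ _ (eqxx _)) h ffunE eqxx subnKC.
  move/ffunP : h => /(_ i); rewrite [in RHS]ffunE (negbTE ci).
  by rewrite eq_sym in ci; rewrite !block_sum_set_cellN.
Qed.

Hypothesis p_ge0 : forall c j, 0 <= p c j.
Hypothesis p_le1 : forall c, cell_mass c <= 1.

Lemma cell_mass_ge0 c : 0 <= cell_mass c.
Proof. exact: sumr_ge0. Qed.

Lemma cell_pmf_ge0 c a : 0 <= cell_pmf c a.
Proof. by rewrite /cell_pmf; case: unliftP => // _; rewrite subr_ge0. Qed.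

Lemma weight_ge0 x : 0 <= weight x.
Proof. by apply: prodr_ge0 => c _; exact: cell_pmf_ge0. Qed.

Lemma block_pmfE v : block_pmf v = \sum_x weight x * (block_sum x == v)%:R.
Proof.
rewrite /block_pmf big_mkcond; apply: eq_bigr => x _.
by case: eqP; rewrite ?mulr1 ?mulr0.
Qed.

Lemma prob_cell_neq0 c : \sum_x weight x * (x c != ord0)%:R = cell_mass c.
Proof.
rewrite (sum_weight_set_cell c).
under [LHS]eq_bigr do under eq_bigr do rewrite ffunE eqxx.
rewrite -big_distrl /= sum_weight mul1r big_ord_recl mulr0 add0r.
by apply: eq_bigr => j _; rewrite cell_pmfS eq_sym neq_lift mulr1.
Qed.

(** Erasing cell [c] changes the configuration only when [x c] is nonzero, which has probability
    [cell_mass c], and two indicators differ by at most 1. *)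
Lemma erased_cell_error c u :
  `|\sum_x weight x * (block_sum (set_cell x c ord0) == u)%:R - block_pmf u|
    <= cell_mass c.
Proof.
rewrite block_pmfE -sumrB -prob_cell_neq0.
apply: le_trans (ler_norm_sum _ _ _) _; apply: ler_sum => x _.
rewrite -mulrBr normrM (ger0_norm (weight_ge0 x)) ler_wpM2l ?weight_ge0//.
case: (eqVneq (x c) ord0) => [xc|_] /=.
  have -> : set_cell x c ord0 = x.
    by apply/ffunP => c'; rewrite ffunE; case: eqP => // ->.
  by rewrite subrr normr0.
by do 2!case: (_ == _); rewrite /= ?subrr ?subr0 ?sub0r ?normrN ?normr1 ?normr0.
Qed.

(** Un-erasing cell [c] in the term of value [j.+1] costs at most [p c j * (k * cell_mass c)], as
    [j.+1 <= k]. Summing over [j] turns [p c j] into a second factor [cell_mass c]. *)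
Lemma block_pmf_recursion (v : {ffun I -> nat}) i :
  `|(v i)%:R * block_pmf v -
    \sum_(j < k) (if (j < v i)%N
            then j.+1%:R * block_mass i j * block_pmf (lower v i j.+1) else 0)|
  <= k%:R * \sum_(c | lab c == i) cell_mass c ^+ 2.
Proof.
(* An exact identity: on the event that the block sums are [v], the number [v i] is the sum of the
   cells of block [i]; each of these cells is then redrawn. *)
have -> : (v i)%:R * block_pmf v = \sum_(c | lab c == i) \sum_j
    p c j * (if (j < v i)%N then j.+1%:R * \sum_x weight x *
      (block_sum (set_cell x c ord0) == lower v i j.+1)%:R else 0).
  rewrite block_pmfE big_distrr /=.
  rewrite (eq_bigr (fun x => \sum_(c | lab c == i)
      weight x * ((x c)%:R * (block_sum x == v)%:R))); last first.
    move=> x _; rewrite mulrCA; case: eqP => [<-|_].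
      by rewrite ffunE natr_sum -big_distrr -big_distrl.
    by rewrite !mulr0 big1// => c _; rewrite !mulr0.
  rewrite exchange_big /=; apply: eq_bigr => c /eqP ci.
  rewrite (sum_weight_set_cell c).
  under [LHS]eq_bigr do rewrite big_ord_recl ffunE eqxx mul0r mulr0 add0r big_distrr /=.
  rewrite exchange_big /=; apply: eq_bigr => j _.
  under [LHS]eq_bigr do rewrite cell_pmfS ffunE eqxx block_sum_eq ci lift0.
  case: ifPn => jv /=.
    rewrite !big_distrr /=; apply: eq_bigr => x _; ring.
  by rewrite [RHS]mulr0 big1// => x _; rewrite !mulr0.
under [X in `|_ - X|]eq_bigr => j _.
  have -> : (if (j < v i)%N then
      j.+1%:R * block_mass i j * block_pmf (lower v i j.+1) else 0) =
    \sum_(c | lab c == i) p c j * (if (j < v i)%N then j.+1%:R *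
      block_pmf (lower v i j.+1) else 0).
    rewrite -big_distrl /= -/(block_mass i j); case: ifP => _; last by rewrite mulr0.
    ring.
  over.
rewrite [X in `|_ - X|]exchange_big /= -sumrB; apply: le_trans (ler_norm_sum _ _ _) _.
rewrite [leRHS]big_distrr /=; apply: ler_sum => c _.
rewrite -sumrB; apply: le_trans (ler_norm_sum _ _ _) _.
rewrite (_ : k%:R * _ = \sum_j p c j * (k%:R * cell_mass c)); last first.
  by rewrite -big_distrl /= -/(cell_mass c); ring.
apply: ler_sum => j _; rewrite -mulrBr normrM ger0_norm// ler_wpM2l//.
case: ifP => _; last by rewrite subrr normr0 mulr_ge0// cell_mass_ge0.
rewrite -mulrBr normrM ger0_norm//; apply: ler_pM => //.
- by rewrite ler_nat.
- exact: erased_cell_error.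
Qed.

(** Every cell lies in a block and values are non-negative, so only the zero configuration
    contributes. *)
Lemma block_pmf0 : block_pmf [ffun=> 0%N] = \prod_c (1 - cell_mass c).
Proof.
rewrite /block_pmf (big_pred1 [ffun=> ord0]) /=.
  by apply: eq_bigr => c _; rewrite ffunE cell_pmf0.
move=> x /=; apply/eqP/eqP => [h|->]; last first.
  by apply/ffunP => i; rewrite !ffunE big1// => c _; rewrite ffunE.
apply/ffunP => c; rewrite ffunE; apply: val_inj => /=.
move/ffunP : h => /(_ (lab c)); rewrite !ffunE (bigD1 c)//=.
by move/eqP; rewrite addn_eq0 => /andP[/eqP].
Qed.

Lemma mean_block_sum i :
  \sum_x weight x * (block_sum x i)%:R = \sum_(j < k) j.+1%:R * block_mass i j.
Proof.
under eq_bigr do rewrite ffunE natr_sum big_distrr /=.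
rewrite exchange_big /=.
under [RHS]eq_bigr do rewrite big_distrr /=.
rewrite [RHS]exchange_big /=; apply: eq_bigr => c _.
rewrite (sum_weight_set_cell c).
under [LHS]eq_bigr do under eq_bigr do rewrite ffunE eqxx.
rewrite -big_distrl /= sum_weight mul1r big_ord_recl mulr0 add0r.
by apply: eq_bigr => j _; rewrite cell_pmfS lift0 mulrC.
Qed.

(** Embeds the finite box {0, ..., B}^I, over which sums can be taken, into the vectors of block
    sums. *)
Definition unbox (B : nat) (v : {ffun I -> 'I_B.+1}) : {ffun I -> nat} :=
  [ffun i => v i : nat].

Lemma block_sum_box (B : nat) (G : {ffun I -> nat} -> R) :
  \sum_(v : {ffun I -> 'I_B.+1}) G (unbox v) * block_pmf (unbox v) =
  \sum_(x | [forall i, block_sum x i <= B]%N) G (block_sum x) * weight x.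
Proof.
rewrite (partition_big (fun x => [ffun i => inord (block_sum x i)] : {ffun I -> 'I_B.+1})
  xpredT)//=.
apply: eq_bigr => v _; rewrite /block_pmf big_distrr /=.
apply: congr_big => // x.
  apply/eqP/andP => [xv|[/forallP xB /eqP <-]].
    split; first by apply/forallP => i; rewrite xv ffunE -ltnS.
    by apply/eqP/ffunP => i; rewrite ffunE xv ffunE inord_val.
  by apply/ffunP => i; rewrite [RHS]ffunE [X in _ = nat_of_ord X]ffunE inordK// ltnS.
by move/eqP => ->.
Qed.

(** Markov's inequality: outside the box some block sum is at least [B.+1], hence so is their total,
    whose mean is the right-hand side. *)
Lemma prob_outside_box (B : nat) :
  B.+1%:R * \sum_(x | ~~ [forall i, block_sum x i <= B]%N) weight x
    <= \sum_i \sum_(j < k) j.+1%:R * block_mass i j.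
Proof.
under [leRHS]eq_bigr do rewrite -mean_block_sum.
rewrite exchange_big /= [leRHS](bigID (fun x => ~~ [forall i, block_sum x i <= B]%N)) /=.
rewrite big_distrr /=; apply: ler_wpDr.
  by apply: sumr_ge0 => x _; apply: sumr_ge0 => i _; rewrite mulr_ge0// weight_ge0.
apply: ler_sum => x; rewrite negb_forall => /existsP[i]; rewrite -ltnNge => xi.
rewrite (bigD1 i)//= mulrC; apply: ler_wpDr.
  by apply: sumr_ge0 => i' _; rewrite mulr_ge0// weight_ge0.
by rewrite ler_wpM2l ?weight_ge0// ler_nat.
Qed.

End CellSums.

(** * The Panjer recursion *)

(** The Leibniz rule. [uniq] is needed because the differentiated factor is singled out by its
    index, through [j != i]. *)
Lemma deriv_prod (A : comNzRingType) (J : eqType) (s : seq J) (F : J -> {poly A}) :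
  uniq s -> (\prod_(j <- s) F j)^`() =
    \sum_(i <- s) (F i)^`() * \prod_(j <- s | j != i) F j.
Proof.
elim: s => [|a s IH]; first by rewrite !big_nil derivC.
move=> /= /andP[as' us]; rewrite !big_cons derivM IH// eqxx /=; congr (_ * _ + _).
  rewrite [RHS]big_seq_cond [LHS]big_seq; apply: eq_bigl => j.
  by case: (boolP (j \in s)) => // js; apply/esym; apply: contraNneq as' => <-.
rewrite big_distrr /= big_seq [RHS]big_seq; apply: eq_bigr => i is'.
rewrite big_cons; case: eqP => [ai|_]; first by rewrite ai is' in as'.
by rewrite /= mulrCA.
Qed.

(** Congruence modulo X^(n+1); it lets polynomials stand for power series. *)
Definition low_coef_eq (A : nzRingType) (n : nat) (f g : {poly A}) : Prop :=
  forall m, (m <= n)%N -> f`_m = g`_m.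

Lemma low_coef_eq_prod (A : nzRingType) n (J : Type) (s : seq J) (Q : pred J)
    (F G : J -> {poly A}) :
  (forall j, low_coef_eq n (F j) (G j)) ->
  low_coef_eq n (\prod_(j <- s | Q j) F j) (\prod_(j <- s | Q j) G j).
Proof.
move=> FG; apply: (big_rec2 (low_coef_eq n)) => [//|j f g _ fg] m mn.
rewrite !coefM; apply: eq_bigr => i _; rewrite FG ?fg//.
  by rewrite (leq_trans _ mn)// leq_subr.
by rewrite (leq_trans _ mn)// -ltnS.
Qed.

Section CompoundPoisson.
Variables (R : realType) (k : nat) (mu : 'I_k -> R).

(* Agrees with exp (mu_j X^(j+1)) up to degree B only. *)
Definition trunc_exp (j : 'I_k) (B : nat) : {poly R} :=
  \sum_(a < B.+1) (mu j ^+ a / a`!%:R) *: 'X^(j.+1 * a).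

(** The truncated form of X d/dX exp(mu X^(j+1)) = (j+1) mu X^(j+1) exp(mu X^(j+1)): the constant
    term drops out, which lowers the truncation by one. *)
Lemma trunc_exp_deriv j B :
  'X * (trunc_exp j B.+1)^`() = (j.+1%:R * mu j) *: ('X^(j.+1) * trunc_exp j B).
Proof.
rewrite /trunc_exp big_ord_recl muln0 derivD derivZ derivC scaler0 add0r.
rewrite (linear_sum (@deriv R)) /= !big_distrr scaler_sumr /=; apply: eq_bigr => a _.
rewrite derivZ derivXn /bump leq0n add1n -!scalerAr mulrnAr -exprS -['X^_ *+ _]scaler_nat.
rewrite prednK ?muln_gt0// -exprD mulnS !scalerA.
congr (_ *: _); rewrite factS natrM exprS.
have := lt0r_neq0 (ltr0Sn R a).
have : (a`!%:R : R) != 0 by rewrite pnatr_eq0 -lt0n fact_gt0.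
by move=> a0 aS; rewrite -mulnS natrM; field; rewrite a0 nat1r aS.
Qed.

Lemma trunc_exp_low j n B : (n <= B)%N ->
  low_coef_eq n (trunc_exp j B) (trunc_exp j n).
Proof.
move=> /subnK <-; elim: (B - n)%N => [//|b IH] m mn.
rewrite addSn /trunc_exp big_ord_recr /= -/(trunc_exp _ _) coefD IH//.
rewrite coefZ coefXn (_ : _ == _ = false) ?mulr0 ?addr0//.
apply/negbTE; rewrite neq_ltn; apply/orP; left.
rewrite (leq_ltn_trans mn)// mulSn -addSn ltn_addr// ltnS leq_addl//.
Qed.

(** The coefficient of X^n in the generating function exp(\sum_j mu_j (X^(j+1) - 1)) of a sum of
    (j+1) N_j, with independent Poisson variables N_j of means mu_j. *)
Definition cpois_pmf (n : nat) : R :=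
  (\prod_j trunc_exp j n)`_n * \prod_j expR (- mu j).

Lemma cpois_pmf_low n B : (n <= B)%N ->
  cpois_pmf n = (\prod_j trunc_exp j B)`_n * \prod_j expR (- mu j).
Proof.
move=> nB; congr (_ * _); apply/esym.
by apply: (@low_coef_eq_prod _ n) => // j; exact: trunc_exp_low.
Qed.

(** The generating function G satisfies X G' = \sum_j (j+1) mu_j X^(j+1) G; the claim compares the
    coefficients of X^n. *)
Lemma cpois_pmf_recursion n :
  n%:R * cpois_pmf n =
  \sum_(j < k) if (j < n)%N then j.+1%:R * mu j * cpois_pmf (n - j.+1)%N else 0.
Proof.
(* Truncating at [n.+1] leaves the differentiated factor truncated at [n], which still suffices. *)
rewrite (cpois_pmf_low (leqnSn n)) mulrA.
have -> : n%:R * (\prod_j trunc_exp j n.+1)`_n =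
    ('X * (\prod_j trunc_exp j n.+1)^`())`_n.
  by rewrite coefXM; case: n => [|n]; rewrite ?mul0r// coef_deriv mulr_natl.
rewrite deriv_prod ?index_enum_uniq// big_distrr /= coef_sum big_distrl /=.
apply: eq_bigr => j _; rewrite mulrA trunc_exp_deriv -scalerAl coefZ.
rewrite -['X^_ * _ * _]mulrA coefXnM ltnS.
rewrite ltnNge; case: ifPn => /= nj; first by rewrite mulr0 mul0r.
rewrite -[LHS]mulrA; congr (_ * _); rewrite (@cpois_pmf_low _ n) ?leq_subr//; congr (_ * _).
rewrite [in RHS](bigD1 j)//= !coefM; apply: eq_bigr => i _; congr (_ * _).
(* The other factors are still truncated at [n.+1], but agree with those at [n] in the degrees
   involved. *)
apply: (@low_coef_eq_prod _ n); last by rewrite (leq_trans (leq_subr _ _))// leq_subr.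
by move=> i' m mn; rewrite (@trunc_exp_low _ n n.+1).
Qed.

End CompoundPoisson.

(** Expanding the product of the truncated exponentials gives one monomial for each choice [v] of
    exponents in ['I_n.+1], the range used in [Theta]; those of degree [n] are exactly
    [Theta k n]. *)
Lemma gprf_pmfE (R : realType) (k : nat) (lambda : 'I_k -> R) a b n :
  gprf_pmf lambda a b n =
  cpois_pmf (fun j => lambda j * (b.1 - a.1) * (b.2 - a.2)) n.
Proof.
set mu := fun j => _.
rewrite /gprf_pmf /cpois_pmf /trunc_exp bigA_distr_bigA /= coef_sum big_distrl /=.
rewrite big_mkcond /=; apply: eq_bigr => v _.
rewrite big_split /= -/mu inE.
have -> : \prod_(i < k) ((mu i ^+ v i / (v i)`!%:R) *: 'X^(i.+1 * v i)) =
    (\prod_(i < k) (mu i ^+ v i / (v i)`!%:R)) *: 'X^(\sum_(i < k) i.+1 * v i).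
  by rewrite scaler_prod prodrXr.
rewrite coefZ coefXn [in RHS]eq_sym; case: eqP => _; first by rewrite mulr1.
by rewrite mulr0 mul0r.
Qed.

(** * Pointwise limit of the block laws *)

Lemma cvgr_sum (R : realType) (J : Type) (s : seq J) (Q : pred J)
    (u : J -> nat -> R) (l : J -> R) :
  (forall j, Q j -> u j n @[n --> \oo] --> l j) ->
  \sum_(j <- s | Q j) u j n @[n --> \oo] --> \sum_(j <- s | Q j) l j.
Proof. by move=> ul; apply: cvg_big => //; exact: add_continuous. Qed.

Lemma cpois_pmf0 (R : realType) (k : nat) (mu : 'I_k -> R) :
  cpois_pmf mu 0 = expR (- \sum_j mu j).
Proof.
rewrite /cpois_pmf coef0_prod big1 ?mul1r.
  by rewrite -sumrN; apply/esym/expR_sum.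
move=> j _; rewrite /trunc_exp big_ord_recl big_ord0 addr0 muln0 expr0 fact0.
by rewrite divr1 scale1r coef1.
Qed.

Lemma expR_le_onem (R : realType) (a : R) : 0 <= a -> a <= 2^-1 ->
  expR (- (a + 2 * a ^+ 2)) <= 1 - a.
Proof.
move=> a0 a1; have a2 : 0 < 1 - a by lra.
rewrite expRN -[leRHS]invrK lef_pV2 ?posrE ?expR_gt0 ?invr_gt0//.
apply: le_trans (expR_ge1Dx _); rewrite -[_^-1]mul1r ler_pdivrMr//.
(* Indeed (1 + a + 2 a^2) (1 - a) = 1 + a^2 (1 - 2 a), which is at least 1. *)
have := mulr_ge0 (sqr_ge0 a) (_ : 0 <= 1 - 2 * a); nra.
Qed.

Section BlockLimit.
Variables (R : realType) (C : nat -> finType) (I : finType) (k : nat).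
Variables (lab : forall n, C n -> I) (p : forall n, C n -> 'I_k -> R).
Hypothesis p_ge0 : forall n c j, 0 <= @p n c j.
Hypothesis p_le1 : forall n c, cell_mass (@p n) c <= 1.
Variable mu : I -> 'I_k -> R.
Hypothesis mass_cvg : forall i j,
  block_mass (@lab n) (@p n) i j @[n --> \oo] --> mu i j.
Hypothesis sqr_mass_cvg0 :
  \sum_(c : C n) cell_mass (@p n) c ^+ 2 @[n --> \oo] --> (0 : R).

Let q n := block_pmf (@lab n) (@p n).

Definition cpois_field_pmf (v : {ffun I -> nat}) : R :=
  \prod_i cpois_pmf (mu i) (v i).

Lemma cpois_field_pmf_recursion (v : {ffun I -> nat}) i :
  (v i)%:R * cpois_field_pmf v =
  \sum_(j < k) if (j < v i)%N
    then j.+1%:R * mu i j * cpois_field_pmf (lower v i j.+1) else 0.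
Proof.
rewrite /cpois_field_pmf (bigD1 i)//= mulrA cpois_pmf_recursion big_distrl /=.
apply: eq_bigr => j _; case: ifP => _; last by rewrite mul0r.
rewrite [in RHS](bigD1 i)//= ffunE eqxx [RHS]mulrA; congr (_ * _).
by apply: eq_bigr => i' /negbTE ii'; rewrite ffunE ii'.
Qed.

(** The product of the factors [1 - cell_mass c] is squeezed between exp(-(S + 2 S2)) and exp(-S),
    where S is the total mass and S2 the sum of the squares. *)
Lemma block_pmf0_cvg : q n [ffun=> 0%N] @[n --> \oo] --> cpois_field_pmf [ffun=> 0%N].
Proof.
pose S n := \sum_(c : C n) cell_mass (@p n) c.
pose S2 n := \sum_(c : C n) cell_mass (@p n) c ^+ 2.
have SE n : S n = \sum_i \sum_j block_mass (@lab n) (@p n) i j.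
  rewrite /S /cell_mass exchange_big /= [RHS]exchange_big /=.
  by apply: eq_bigr => j _; rewrite (partition_big (@lab n) xpredT).
have Scvg : S n @[n --> \oo] --> \sum_i \sum_j mu i j.
  rewrite (_ : S = fun n => \sum_i \sum_j block_mass (@lab n) (@p n) i j); last exact/funext.
  by apply: cvgr_sum => i _; apply: cvgr_sum.
have -> : cpois_field_pmf [ffun=> 0%N] = expR (- \sum_i \sum_j mu i j).
  rewrite /cpois_field_pmf -sumrN expR_sum; apply: eq_bigr => i _.
  by rewrite ffunE cpois_pmf0.
apply: (@squeeze_cvgr _ _ _ _ (fun n => expR (- (S n + 2 * S2 n)))
    (fun n => expR (- S n))).
(* Once [S2 n <= 1/4], each single cell mass is at most 1/2, as [expR_le_onem] requires. *)
- have /cvgrPdist_le/(_ (4^-1) ltac:(lra)) := sqr_mass_cvg0.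
  apply: filterS => n; rewrite sub0r normrN ger0_norm; last first.
    by apply: sumr_ge0 => c _; exact: sqr_ge0.
  move=> S2n; rewrite /q block_pmf0; apply/andP; split; last first.
    rewrite /S -sumrN expR_sum; apply: ler_prod => c _.
    rewrite subr_ge0 p_le1/=; exact: expR_ge1Dx.
  rewrite /S /S2 big_distrr -big_split /= -sumrN expR_sum; apply: ler_prod => c _.
  rewrite expR_ge0 /= expR_le_onem ?cell_mass_ge0//.
  rewrite -(@ler_pXn2r _ 2)// ?nnegrE ?cell_mass_ge0// ?invr_ge0//.
  rewrite (_ : 2^-1 ^+ 2 = 4^-1); last by rewrite exprVn -natrX.
  apply: le_trans S2n; rewrite (bigD1 c)//= lerDl.
  by apply: sumr_ge0 => c' _; exact: sqr_ge0.
- apply: (cvg_comp _ expR _ (@continuous_expR R _)); apply: cvgN.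
  rewrite -[X in _ --> X]addr0 -[X in _ + X](mulr0 2); apply: cvgD => //.
  exact: cvgMl_tmp.
- by apply: (cvg_comp _ expR _ (@continuous_expR R _)); exact: cvgN.
Qed.

Lemma block_pmf_cvg v : q n v @[n --> \oo] --> cpois_field_pmf v.
Proof.
have [m] := ubnP (\sum_i v i)%N; elim: m v => // m IH v vm.
have [[i vi]|v0] := pselect (exists i, (0 < v i)%N); last first.
  rewrite (_ : v = [ffun=> 0%N]); first exact: block_pmf0_cvg.
  apply/ffunP => i; rewrite ffunE; apply/eqP; rewrite -leqn0 leqNgt.
  by apply/negP => vi; apply: v0; exists i.
pose e n := (v i)%:R * q n v - \sum_(j < k) if (j < v i)%N
  then j.+1%:R * block_mass (@lab n) (@p n) i j * q n (lower v i j.+1) else 0.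
have e0 : e n @[n --> \oo] --> (0 : R).
  apply/norm_cvg0P; apply: (@squeeze_cvgr _ _ _ _ (fun=> 0)
      (fun n => k%:R * \sum_(c : C n) cell_mass (@p n) c ^+ 2)).
  - near=> n; rewrite normr_ge0/=.
    apply: le_trans (block_pmf_recursion _ (p_ge0 (n:=n)) (p_le1 (n:=n)) v i) _.
    rewrite ler_wpM2l// [leRHS](bigID (fun c => lab c == i)) /= lerDl.
    by apply: sumr_ge0 => c _; exact: sqr_ge0.
  - exact: cvg_cst.
  - by rewrite -[X in _ --> X](mulr0 k%:R); exact: cvgMl_tmp.
have vi0 : (v i)%:R != 0 :> R by rewrite pnatr_eq0 -lt0n.
have qE n : q n v = (v i)%:R^-1 * (e n + \sum_(j < k) if (j < v i)%N
  then j.+1%:R * block_mass (@lab n) (@p n) i j * q n (lower v i j.+1) else 0).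
  by rewrite /e subrK mulrA mulVf// mul1r.
rewrite (funext qE : q ^~ v = _).
rewrite -[X in _ --> X](mulKf vi0) cpois_field_pmf_recursion -[X in _^-1 * X]add0r.
apply: cvgMl_tmp; apply: cvgD => //; apply: cvgr_sum => j _.
case: ifPn => jv; last exact: cvg_cst.
apply: cvgM; first exact: cvgMl_tmp.
apply: IH; rewrite -ltnS (leq_trans _ vm)// ltnS (bigD1 i)//= [X in (_ < X)%N](bigD1 i)//=.
rewrite ffunE eqxx -addSn leq_add//; first by rewrite ltn_subrL.
by apply: leq_sum => i' /negbTE ii'; rewrite ffunE ii'.
Unshelve. all: by end_near. Qed.

(** Both bounds hold for the block laws and pass to the limit on the finite box; the infinite series
    of the limit weights never has to be summed. *)
Lemma cpois_field_box B :
  1 - (\sum_i \sum_(j < k) j.+1%:R * mu i j) / B.+1%:R <=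
  \sum_(v : {ffun I -> 'I_B.+1}) cpois_field_pmf (unbox v) <= 1.
Proof.
have boxE n : \sum_(v : {ffun I -> 'I_B.+1}) q n (unbox v) =
    1 - \sum_(x | ~~ [forall i, block_sum (@lab n) x i <= B]%N) weight (@p n) x.
  rewrite -(sum_weight (@p n)) (bigID (fun x => [forall i, block_sum (@lab n) x i <= B]%N)) /=.
  rewrite addrK -[RHS](eq_bigr _ (fun x _ => mul1r _)).
  rewrite -(block_sum_box (@lab n) (@p n) B (fun=> 1)).
  by apply: eq_bigr => v _; rewrite mul1r.
have qcvg : \sum_(v : {ffun I -> 'I_B.+1}) q n (unbox v) @[n --> \oo] -->
    \sum_(v : {ffun I -> 'I_B.+1}) cpois_field_pmf (unbox v).
  by apply: cvgr_sum => v _; exact: block_pmf_cvg.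
apply/andP; split; last first.
  apply: (cvgr_to_le qcvg); apply: nearW => n.
  by rewrite boxE gerBl; apply: sumr_ge0 => x _; exact: weight_ge0.
apply: (@ler_cvg_to _ \oo _ _ (fun n => 1 -
    (\sum_i \sum_(j < k) j.+1%:R * block_mass (@lab n) (@p n) i j) / B.+1%:R)
    _ _ _ _ qcvg).
- apply: cvgB; first exact: cvg_cst.
  apply: cvgMr_tmp; apply: cvgr_sum => i _; apply: cvgr_sum => j _.
  exact: cvgMl_tmp.
- apply: nearW => n; rewrite boxE lerD2l lerN2 ler_pdivlMr// mulrC.
  exact: prob_outside_box.
Qed.

End BlockLimit.

(** * Expectations approximated on finitely many events *)

Section Approximation.
Context (R : realType) (d : measure_display) (T : measurableType d).
Variable P : probability T R.

Lemma bounded_integrable (F : T -> R) (C : R) :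
  measurable_fun setT F -> (forall w, `|F w| <= C) ->
  P.-integrable setT (EFin \o F).
Proof.
move=> mF FC; apply: measurable_bounded_integrable => //.
  by rewrite -ge0_fin_numE// fin_num_measure.
exists C; split; first exact: num_real.
by move=> M CM w _; exact: le_trans (FC w) (ltW CM).
Qed.

Lemma integrable_indicr (A : set T) : measurable A -> P.-integrable setT (EFin \o \1_A).
Proof. exact: integrable_indic. Qed.

Lemma integrable_step (V : Type) (s : seq V) (E : V -> set T) (a : V -> R) :
  (forall v, measurable (E v)) ->
  P.-integrable setT (EFin \o (fun w => \sum_(v <- s) a v * \1_(E v) w)).
Proof.
move=> mE; rewrite (_ : _ \o _ = fun w => (\sum_(v <- s) (a v * \1_(E v) w)%:E)%E).
  apply: integrable_sum => // v _.
  exact: (integrableZl measurableT (a v) (integrable_indicr (mE v))).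
by apply/funext => w /=; rewrite sumEFin.
Qed.

Lemma Rintegral_step (V : Type) (s : seq V) (E : V -> set T) (a : V -> R) :
  (forall v, measurable (E v)) ->
  (\int[P]_w (\sum_(v <- s) a v * \1_(E v) w))%R = \sum_(v <- s) a v * fine (P (E v)).
Proof.
move=> mE; elim: s => [|v s IH].
  by rewrite big_nil; under eq_Rintegral do rewrite big_nil; rewrite Rintegral_cst// mul0r.
under eq_Rintegral do rewrite big_cons.
rewrite RintegralD//; last 2 first.
- exact: (integrableZl measurableT (a v) (integrable_indicr (mE v))).
- exact: integrable_step.
rewrite IH big_cons RintegralZl//; last exact: integrable_indicr.
by rewrite [X in a v * X]/Rintegral integral_indic// setIT.
Qed.

(** On the disjoint events [E v] the step function equals [F]; elsewhere it is 0 and [F] is bounded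
    by [C]. Hence the difference is dominated pointwise by [C] times the indicator of the
    complement. *)
Lemma expectation_approx (V : finType) (E : V -> set T) (g : V -> R)
    (F : T -> R) (C : R) :
  (forall v, measurable (E v)) ->
  (forall v v' w, E v w -> E v' w -> v = v') ->
  measurable_fun setT F -> (forall w, `|F w| <= C) ->
  (forall v w, E v w -> F w = g v) ->
  `|fine 'E_P[F] - \sum_v g v * fine (P (E v))|
    <= C * (1 - \sum_v fine (P (E v))).
Proof.
move=> mE disjE mF FC Fg.
have iF := bounded_integrable mF FC.
have -> : fine 'E_P[F] = (\int[P]_w F w)%R by rewrite unlock.
rewrite -Rintegral_step// -RintegralB//; last exact: integrable_step.
have iK : P.-integrable setT (EFin \o (fun w => C - \sum_v C * \1_(E v) w)).
  exact: (integrableB measurableT (finite_measure_integrable_cst P C measurableT)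
    (integrable_step (index_enum V) (fun=> C) mE)).
have -> : C * (1 - \sum_v fine (P (E v))) =
    (\int[P]_w (C - \sum_v C * \1_(E v) w))%R.
  rewrite RintegralB//; last 2 first.
  - exact: finite_measure_integrable_cst.
  - exact: integrable_step.
  rewrite Rintegral_step// Rintegral_cst//.
  rewrite [X in fine X](probability_setT P) mulr1.
  by rewrite -big_distrr /= mulrBr mulr1.
have iH : P.-integrable setT (EFin \o (fun w => F w - \sum_v g v * \1_(E v) w)).
  exact: (integrableB measurableT iF (integrable_step _ _ mE)).
apply: le_trans (le_normr_Rintegral _ iH) _ => //.
apply: le_Rintegral => // [|w _]; first exact: (integrable_norm iH).
have [[v Ev]|nE] := pselect (exists v, E v w).
  have sumE (h : V -> R) : \sum_u h u * \1_(E u) w = h v.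
    rewrite (bigD1 v)//= indicE mem_set// mulr1 big1 ?addr0// => u uv.
    rewrite indicE memNset ?mulr0// => Eu.
    by rewrite (disjE _ _ _ Eu Ev) eqxx in uv.
  by rewrite !sumE (Fg _ _ Ev) !subrr normr0.
have sumE (h : V -> R) : \sum_u h u * \1_(E u) w = 0.
  by apply: big1 => u _; rewrite indicE memNset ?mulr0// => Eu; apply: nE; exists u.
by rewrite !sumE !subr0.
Qed.

Lemma bounded_expectation_fin_num (F : T -> R) (C : R) :
  measurable_fun setT F -> (forall w, `|F w| <= C) -> 'E_P[F]%E \is a fin_num.
Proof.
by move=> mF FC; rewrite unlock; exact: integrable_fin_num (bounded_integrable mF FC).
Qed.

(** Any preimage is a countable union of fibres of [xi], so [h] can be arbitrary. *)
Lemma measurable_countable_comp (V : countType) (xi : T -> V) (h : V -> R) :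
  (forall v, measurable (xi @^-1` [set v])) -> measurable_fun setT (h \o xi).
Proof.
move=> mxi _ B _; rewrite setTI.
rewrite (_ : _ @^-1` B = \bigcup_(v in [set v | B (h v)]) (xi @^-1` [set v])).
  rewrite bigcup_mkcond; apply: countable_bigcupT_measurable => [|v].
    exact: countableP.
  by case: ifP => // _; exact: mxi.
apply/seteqP; split => [w Bw|w [v /= Bv xiv]]; first by exists (xi w).
by rewrite /= xiv.
Qed.

Lemma measurable_continuous_row (r : nat) (Y : 'I_r -> T -> R) (f : 'rV[R]_r -> R) :
  continuous f -> (forall i, measurable_fun setT (Y i)) ->
  measurable_fun setT (fun w => f (\row_i Y i w)).
Proof.
move=> cf mY.
(* Rounding Y down to multiples of 1/(n+1) leaves countably many values. *)
pose xi n w : {ffun 'I_r -> int} := [ffun i => Num.floor (n.+1%:R * Y i w)].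
apply: (@measurable_fun_cvg _ _ _ _
    (fun n w => f (\row_i ((xi n w i)%:~R / n.+1%:R)))) => [n|w _].
  apply: (@measurable_countable_comp _ (xi n)
    (fun v : {ffun 'I_r -> int} => f (\row_i ((v i)%:~R / n.+1%:R)))) => v.
  rewrite (_ : _ @^-1` _ = \big[setI/setT]_(i <- index_enum 'I_r)
      (Y i @^-1` `[(v i)%:~R / n.+1%:R, (v i + 1)%:~R / n.+1%:R[)).
    apply: bigsetI_measurable => i _; rewrite -[X in measurable X]setTI.
    exact: mY.
  rewrite -bigcap_seq; apply/seteqP; split => [w <- i _|w /= vw].
    rewrite /= in_itv/= ffunE ler_pdivrMr// ltr_pdivlMr// ![Y i w * _]mulrC.
    by rewrite floor_le floorD1_gt.
  apply/ffunP => i; rewrite ffunE; apply/eqP; rewrite floor_eq.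
  have := vw i (mem_index_enum i).
  by rewrite /= !in_itv/= ler_pdivrMr// ltr_pdivlMr// ![Y i w * _]mulrC.
(* By continuity of [f] it is enough that the rounded rows converge; each entry is off by at most
   1/(n+1). *)
apply: (cvg_comp _ f _ (cf _)).
apply/cvg_ballP => e e0; near=> n; split => // i0 i.
rewrite (ord1 i0) !mxE ffunE.
have n0 : 0 < n.+1%:R :> R by [].
have := floor_itv (n.+1%:R * Y i w); set m := Num.floor _; rewrite intrD => /andP[mY1 mY2].
have ne : n.+1%:R^-1 < e by near: n; exact: near_infty_natSinv_lt (PosNum e0).
rewrite /ball /= /ball_ ger0_norm.
  rewrite (le_lt_trans _ ne)// lerBlDr -[X in _ <= X + _]mul1r -mulrDl.
  by rewrite ler_pdivlMr// mulrC addrC ltW.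
by rewrite subr_ge0 ler_pdivrMr// mulrC.
Unshelve. all: by end_near. Qed.

End Approximation.

(** * Grids of cells *)

(** The index of the interval [N i, N i.+1) containing [m]. Taking the least [i] skips empty
    intervals when [N] repeats a value; [ord_max] is the default when no [i] qualifies. *)
Definition strip (r : nat) (N : nat -> nat) (m : nat) : 'I_r.+1 :=
  [arg min_(i < ord_max | (m < N i.+1)%N) (i : nat)].

Lemma strip_le r (N : nat -> nat) m (i : 'I_r.+1) :
  {homo N : a b / (a <= b)%N} -> (m < N r.+1)%N ->
  (strip r N m <= i)%N = (m < N i.+1)%N.
Proof.
move=> homoN mN; rewrite /strip; case: arg_minnP => // i0 mi0 min_i0.
apply/idP/idP => [i0i|]; last exact: min_i0.
exact: leq_trans mi0 (homoN _ _ _).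
Qed.

Lemma strip_eq r (N : nat -> nat) m (i : 'I_r.+1) :
  {homo N : a b / (a <= b)%N} -> N 0%N = 0%N -> (m < N r.+1)%N ->
  (strip r N m == i) = (N i <= m)%N && (m < N i.+1)%N.
Proof.
move=> homoN N0 mN; rewrite -val_eqE eqn_leq strip_le// andbC; congr (_ && _).
case: i => -[|i] ir /=; first by rewrite N0 !leq0n.
have ir' : (i < r.+1)%N by rewrite ltnW.
by rewrite ltnNge (strip_le (Ordinal ir'))//= leqNgt negbK.
Qed.

(** Places sums with different bounds over one common index type; the ordinals start at 0, hence the
    successors. *)
Lemma sum_cells (V : nmodType) (A B a b : nat) (f : nat -> nat -> V) :
  (a <= A)%N -> (b <= B)%N ->
  \sum_(1 <= m < a.+1) \sum_(1 <= l < b.+1) f m l =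
  \sum_(c : 'I_A * 'I_B | (c.1 < a)%N && (c.2 < b)%N) f c.1.+1 c.2.+1.
Proof.
move=> aA bB; rewrite -(pair_big (fun m : 'I_A => (m < a)%N) (fun l : 'I_B => (l < b)%N)
  (fun m l => f m.+1 l.+1)) /=.
rewrite big_add1 /= big_mkord (big_ord_widen _ (fun m => \sum_(1 <= l < b.+1) f m.+1 l) aA).
apply: eq_bigr => m _.
by rewrite big_add1 /= big_mkord (big_ord_widen _ (fun l => f m.+1 l.+1) bB).
Qed.

Lemma sum_strips r r' (N N' : nat -> nat) (x : 'I_(N r.+1) * 'I_(N' r'.+1) -> nat)
    (i : 'I_r.+1) (i' : 'I_r'.+1) :
  {homo N : a b / (a <= b)%N} -> {homo N' : a b / (a <= b)%N} ->
  (\sum_(c : 'I_(N r.+1) * 'I_(N' r'.+1) | (c.1 < N i.+1) && (c.2 < N' i'.+1)) x c =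
   \sum_(u : 'I_r.+1 * 'I_r'.+1 | (u.1 <= i) && (u.2 <= i'))
     \sum_(c : 'I_(N r.+1) * 'I_(N' r'.+1) | (strip r N c.1, strip r' N' c.2) == u) x c)%N.
Proof.
move=> homoN homoN'.
rewrite (partition_big (fun c : 'I_(N r.+1) * 'I_(N' r'.+1) =>
  (strip r N c.1, strip r' N' c.2))
  (fun u => (u.1 <= i) && (u.2 <= i'))%N)/=; last first.
  by move=> c; rewrite !strip_le.
apply: eq_bigr => u ui; apply: eq_bigl => c; rewrite andbC.
by case: eqP => //= cu; rewrite -!strip_le//; move: ui; rewrite -cu.
Qed.

Lemma telescope_le (V : zmodType) r (f : nat -> V) (i : 'I_r.+1) :
  \sum_(u < r.+1 | (u <= i)%N) (f u.+1 - f u) = f i.+1 - f 0%N.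
Proof.
rewrite -(telescope_sumr f (leq0n _)) big_mkord.
by rewrite (big_ord_widen _ (fun u => f u.+1 - f u) (ltn_ord i)).
Qed.

(** * Probability mass of the blocks of a grid *)

Section GridMass.
Variables (R : realType) (k : nat) (lambda : 'I_k -> R).
Variable p : nat -> nat -> nat -> 'I_k -> R.

Definition mass_upto (n : nat) (s t : R) (j : 'I_k) : R :=
  \sum_(1 <= m < (Num.truncn (n%:R * s)).+1)
    \sum_(1 <= l < (Num.truncn (n%:R * t)).+1) p n m l j.

Hypothesis mass_upto_cvg : forall (j : 'I_k) (s t : R), 0 <= s -> 0 <= t ->
  mass_upto n s t j @[n --> \oo] --> lambda j * s * t.
Hypothesis p_ge0 : forall n m l j,
  (1 <= n)%N -> (1 <= m)%N -> (1 <= l)%N -> 0 <= p n m l j.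

Definition scaled (S : nat -> R) (n q : nat) : nat := Num.truncn (n%:R * S q).

Definition cells (s t : R) (n : nat) : finType :=
  ('I_(Num.truncn (n%:R * s)) * 'I_(Num.truncn (n%:R * t)))%type.

Definition cell_prob (s t : R) n (c : cells s t n) (j : 'I_k) : R :=
  p n c.1.+1 c.2.+1 j.

Definition cell_strips (s t : R) (S T : nat -> R) (r r' n : nat) (c : cells s t n) :=
  (strip r (scaled S n) c.1, strip r' (scaled T n) c.2).

(** There is no cell at [n = 0], so assumptions made for [1 <= n] apply to every existing cell. *)
Lemma cells_gt0 s t n : cells s t n -> (0 < n)%N.
Proof. by case: n => // -[[m]]; rewrite mul0r truncn0. Qed.

Lemma cell_prob_ge0 s t n (c : cells s t n) j : 0 <= cell_prob c j.
Proof. by apply: p_ge0 => //; exact: cells_gt0 c. Qed.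

Lemma homo_scaled (S : nat -> R) n : {homo S : a b / (a <= b)%N >-> a <= b} ->
  {homo scaled S n : a b / (a <= b)%N}.
Proof. by move=> homoS a b ab; apply: le_truncn; rewrite ler_wpM2l// homoS. Qed.

Lemma scaled0 (S : nat -> R) n : S 0%N = 0 -> scaled S n 0 = 0%N.
Proof. by rewrite /scaled => ->; rewrite mulr0 truncn0. Qed.

Lemma mass_uptoE (S T : nat -> R) r r' n a b j :
  {homo S : a b / (a <= b)%N >-> a <= b} -> {homo T : a b / (a <= b)%N >-> a <= b} ->
  (a <= r)%N -> (b <= r')%N ->
  mass_upto n (S a) (T b) j = \sum_(c : cells (S r) (T r') n)
    (c.1 < scaled S n a)%N%:R * (c.2 < scaled T n b)%N%:R * cell_prob c j.
Proof.
move=> homoS homoT ar br; rewrite /mass_upto (@sum_cells _ (scaled S n r) (scaled T n r')).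
- rewrite big_mkcond; apply: eq_bigr => c _.
  by case: ifPn; do 2!case: (_ < _)%N; rewrite // ?mul1r ?mul0r ?mulr0 ?mul0r.
- exact: homo_scaled.
- exact: homo_scaled.
Qed.

Lemma block_mass_strips (S T : nat -> R) r r' n
    (i : 'I_r.+1 * 'I_r'.+1) (j : 'I_k) :
  S 0%N = 0 -> T 0%N = 0 ->
  {homo S : a b / (a <= b)%N >-> a <= b} -> {homo T : a b / (a <= b)%N >-> a <= b} ->
  block_mass (@cell_strips (S r.+1) (T r'.+1) S T r r' n)
    (@cell_prob (S r.+1) (T r'.+1) n) i j =
  mass_upto n (S i.1.+1) (T i.2.+1) j - mass_upto n (S i.1) (T i.2.+1) j
  - mass_upto n (S i.1.+1) (T i.2) j + mass_upto n (S i.1) (T i.2) j.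
Proof.
move=> S0 T0 homoS homoT; case: i => i i' /=.
have ir := ltn_ord i; have ir' := ltn_ord i'.
rewrite !(@mass_uptoE S T r.+1 r'.+1)// 1?ltnW//.
rewrite -!sumrB -big_split /= /block_mass big_mkcond /=; apply: eq_bigr => c _.
have hS := homo_scaled n homoS; have hT := homo_scaled n homoT.
rewrite /cell_strips xpair_eqE.
rewrite (strip_eq i hS (scaled0 n S0) (ltn_ord c.1)) !(leqNgt (scaled S n i)).
rewrite (strip_eq i' hT (scaled0 n T0) (ltn_ord c.2)) !(leqNgt (scaled T n i')).
(* Monotonicity excludes lying below the lower edge of a strip but not below its upper edge; in all
   other cases the indicator of the block is the alternating sum of the four corner indicators. *)
have : (c.1 < scaled S n i)%N -> (c.1 < scaled S n i.+1)%N.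
  by move/leq_trans; apply; exact: hS.
have : (c.2 < scaled T n i')%N -> (c.2 < scaled T n i'.+1)%N.
  by move/leq_trans; apply; exact: hT.
move: (cell_prob c j) => x.
move: (c.1 < scaled S n i)%N (c.1 < scaled S n i.+1)%N => b1 b2.
move: (c.2 < scaled T n i')%N (c.2 < scaled T n i'.+1)%N => b3 b4.
case: b1; case: b2; case: b3; case: b4 => //= h1 h2;
  by [ring | have := h1 isT | have := h2 isT].
Qed.

Lemma block_mass_strips_cvg (S T : nat -> R) r r'
    (i : 'I_r.+1 * 'I_r'.+1) (j : 'I_k) :
  S 0%N = 0 -> T 0%N = 0 ->
  {homo S : a b / (a <= b)%N >-> a <= b} -> {homo T : a b / (a <= b)%N >-> a <= b} ->
  block_mass (@cell_strips (S r.+1) (T r'.+1) S T r r' n)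
    (@cell_prob (S r.+1) (T r'.+1) n) i j
    @[n --> \oo] -->
  lambda j * (S i.1.+1 - S i.1) * (T i.2.+1 - T i.2).
Proof.
move=> S0 T0 homoS homoT.
have Sge0 q : 0 <= S q by rewrite -S0 homoS.
have Tge0 q : 0 <= T q by rewrite -T0 homoT.
rewrite (funext (fun n => @block_mass_strips S T r r' n i j S0 T0 homoS homoT)).
rewrite (_ : lambda j * _ * _ = lambda j * S i.1.+1 * T i.2.+1 -
  lambda j * S i.1 * T i.2.+1 - lambda j * S i.1.+1 * T i.2 +
  lambda j * S i.1 * T i.2); last by ring.
by apply: cvgD; [apply: cvgB; [apply: cvgB|]|]; exact: mass_upto_cvg.
Qed.

(* Each cell lies in one of K vertical strips, whose total mass tends to a
   quantity of order 1/K: the mass hypothesis alone forces small cells. *)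
Lemma cell_prob_small (s t : R) (e : R) : 0 <= s -> 0 <= t -> 0 < e ->
  \forall n \near \oo, forall (c : cells s t n) j, cell_prob c j <= e.
Proof.
move=> s0 t0 e0.
(* Absolute values, since no sign is assumed for [lambda] here; [L] dominates every limit mass at
   once. *)
pose L := \sum_j `|lambda j * s * t|.
have [K KL] : exists K : nat, L / K.+1%:R < e / 2.
  have L0 : 0 <= L by apply: sumr_ge0.
  exists (Num.truncn (L / (e / 2))).
  rewrite ltr_pdivrMr// mulrC -ltr_pdivrMr ?divr_gt0//.
  exact: truncnS_gt.
(* [K.+1] equal vertical strips, each of full height [t]. *)
pose S q : R := s * (q%:R / K.+1%:R); pose T q : R := t * q%:R.
have S0 : S 0%N = 0 by rewrite /S mul0r mulr0.
have T0 : T 0%N = 0 by rewrite /T mulr0.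
have homoS : {homo S : a b / (a <= b)%N >-> a <= b}.
  by move=> a b ab; rewrite ler_wpM2l// ler_wpM2r// ler_nat.
have homoT : {homo T : a b / (a <= b)%N >-> a <= b}.
  by move=> a b ab; rewrite ler_wpM2l// ler_nat.
have SK : S K.+1 = s by rewrite /S divff ?mulr1.
have T1 : T 1%N = t by rewrite /T mulr1.
rewrite -SK -T1.
have small (i : 'I_K.+1 * 'I_1) (j : 'I_k) : \forall n \near \oo,
    block_mass (@cell_strips (S K.+1) (T 1) S T K 0 n) (@cell_prob _ _ n) i j <= e.
  apply: (cvgr_le _ (@block_mass_strips_cvg S T K 0 i j S0 T0 homoS homoT)).
  rewrite -mulrA (_ : (S _ - _) * (T _ - _) = s * t / K.+1%:R); last first.
    by rewrite /S /T -!natr1; field; rewrite natr1.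
  rewrite !mulrA; apply: le_lt_trans (_ : _ <= L / K.+1%:R) _.
    rewrite ler_wpM2r//; apply: le_trans (ler_norm _) _.
    by rewrite /L (bigD1 j)//= lerDl sumr_ge0.
  by apply: lt_le_trans KL _; lra.
have small_all : \forall n \near \oo, forall j i,
    block_mass (@cell_strips (S K.+1) (T 1) S T K 0 n) (@cell_prob _ _ n) i j <= e.
  by apply: filter_forall => j; apply: filter_forall => i; exact: small.
apply: filterS small_all => n small_n c j.
have := small_n j (cell_strips S T K 0 c); apply: le_trans.
rewrite /block_mass (bigD1 c)//= lerDl; apply: sumr_ge0 => c' _.
exact: cell_prob_ge0.
Qed.

(** The sum of squares is at most the largest cell mass, which vanishes, times the total mass, which
    stays bounded. *)
Lemma sqr_cell_mass_cvg0 (s t : R) : 0 <= s -> 0 <= t ->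
  \sum_(c : cells s t n) cell_mass (@cell_prob s t n) c ^+ 2 @[n --> \oo] --> (0 : R).
Proof.
move=> s0 t0.
pose S q : R := s * q%:R; pose T q : R := t * q%:R.
have homoS : {homo S : a b / (a <= b)%N >-> a <= b}.
  by move=> a b ab; rewrite ler_wpM2l// ler_nat.
have homoT : {homo T : a b / (a <= b)%N >-> a <= b}.
  by move=> a b ab; rewrite ler_wpM2l// ler_nat.
have S1 : S 1%N = s by rewrite /S mulr1.
have T1 : T 1%N = t by rewrite /T mulr1.
pose W n := \sum_j mass_upto n s t j.
have WE n : W n = \sum_(c : cells s t n) cell_mass (@cell_prob s t n) c.
  rewrite /W /cell_mass [RHS]exchange_big /=; apply: eq_bigr => j _.
  have := @mass_uptoE S T 1 1 n 1 1 j homoS homoT isT isT.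
  rewrite S1 T1 => ->; apply: eq_bigr => c _.
  by rewrite /scaled S1 T1 !ltn_ord !mul1r.
have Wcvg : W n @[n --> \oo] --> \sum_j lambda j * s * t.
  by apply: cvgr_sum => j _; exact: mass_upto_cvg.
set L := \sum_j _ in Wcvg.
apply/cvgr0Pnorm_le => e e0.
(* Cells below e/D have mass at most k e/D, and the total mass is eventually at most |L| + 1; the
   last 1 keeps [D] positive. *)
pose D := (k%:R * (`|L| + 1) + 1).
have D0 : 0 < D by rewrite ltr_wpDl// mulr_ge0// addr_ge0.
have WL : \forall n \near \oo, W n <= `|L| + 1.
  by apply: (cvgr_le _ Wcvg); rewrite (le_lt_trans (ler_norm L))// ltrDl.
apply: filterS2 WL (cell_prob_small s0 t0 (divr_gt0 e0 D0)) => n Wn small.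
rewrite ger0_norm; last by apply: sumr_ge0 => c _; exact: sqr_ge0.
apply: le_trans (_ : _ <= \sum_(c : cells s t n)
  k%:R * (e / D) * cell_mass (@cell_prob s t n) c) _.
  apply: ler_sum => c _; rewrite expr2 ler_wpM2r//.
    by apply: sumr_ge0 => j _; exact: cell_prob_ge0.
  apply: le_trans (ler_sum _ (fun j _ => small c j)) _.
  by rewrite sumr_const card_ord mulr_natl.
rewrite -big_distrr /= -WE; apply: le_trans (_ : _ <= k%:R * (e / D) * (`|L| + 1)) _.
  by rewrite ler_wpM2l// mulr_ge0// divr_ge0// ltW.
rewrite [X in X <= _](_ : _ = e * (k%:R * (`|L| + 1)) / D); last by ring.
by rewrite ler_pdivrMr// ler_wpM2l ?(ltW e0)// lerDl.
Qed.

End GridMass.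

(** * Convergence of expectations *)

Section ExpectationLimit.
Context (R : realType) (d : measure_display) (T : measurableType d).
Context (P : probability T R) (d' : measure_display) (T' : measurableType d').
Variable P' : probability T' R.
Variables (C : nat -> finType) (I : finType) (k : nat).
Variables (lab : forall n, C n -> I) (p : forall n, C n -> 'I_k -> R).
Hypothesis p_ge0 : forall n c j, 0 <= @p n c j.
Hypothesis p_le1 : forall n c, cell_mass (@p n) c <= 1.
Variable mu : I -> 'I_k -> R.
Hypothesis mass_cvg : forall i j,
  block_mass (@lab n) (@p n) i j @[n --> \oo] --> mu i j.
Hypothesis sqr_mass_cvg0 :
  \sum_(c : C n) cell_mass (@p n) c ^+ 2 @[n --> \oo] --> (0 : R).
Variables (h : {ffun I -> nat} -> R) (b : R).
Variables (F : nat -> T -> R) (G : T' -> R).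
Hypotheses (mF : forall n, measurable_fun setT (F n)) (mG : measurable_fun setT G).
Hypotheses (Fb : forall n w, `|F n w| <= b) (Gb : forall w, `|G w| <= b).
Hypothesis hb : forall v, `|h v| <= b.
Variable E : forall n, {ffun C n -> 'I_k.+1} -> set T.
Hypothesis mE : forall n x, measurable (@E n x).
Hypothesis disjE : forall n (x x' : {ffun C n -> 'I_k.+1}) w, E x w -> E x' w -> x = x'.
Hypothesis PE : forall n x, P (@E n x) = (weight (@p n) x)%:E.
Hypothesis FE : forall n (x : {ffun C n -> 'I_k.+1}) w,
  E x w -> F n w = h (block_sum (@lab n) x).
Variable E' : {ffun I -> nat} -> set T'.
Hypothesis mE' : forall v, measurable (E' v).
Hypothesis disjE' : forall v v' w, E' v w -> E' v' w -> v = v'.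
Hypothesis PE' : forall v, P' (E' v) = (cpois_field_pmf mu v)%:E.
Hypothesis GE' : forall v w, E' v w -> G w = h v.

(** The events [E x] carry total probability 1, so the error in [expectation_approx] is zero. *)
Lemma expectation_discreteE n :
  fine 'E_P[F n] = \sum_x h (block_sum (@lab n) x) * weight (@p n) x.
Proof.
have := expectation_approx P (g := fun x => h (block_sum (@lab n) x))
  (@mE n) (@disjE n) (mF n) (Fb n) (@FE n).
under [X in `|_ - X|]eq_bigr do rewrite PE /=.
under [X in _ <= _ * (_ - X)]eq_bigr do rewrite PE /=.
by rewrite sum_weight subrr mulr0 normr_le0 subr_eq0 => /eqP.
Qed.

Lemma unbox_inj B : injective (@unbox I B).
Proof.
by move=> v v' /ffunP vv'; apply/ffunP => i; have := vv' i; rewrite !ffunE => /val_inj.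
Qed.

Lemma bound_ge0 : 0 <= b.
Proof. by apply: le_trans (hb [ffun=> 0%N]); exact: normr_ge0. Qed.

Let K := \sum_i \sum_(j < k) j.+1%:R * mu i j.

Lemma limit_expectation_box B :
  `|fine 'E_P'[G] - \sum_(v : {ffun I -> 'I_B.+1})
      h (unbox v) * cpois_field_pmf mu (unbox v)| <= b * (K / B.+1%:R).
Proof.
have := expectation_approx P' (V := {ffun I -> 'I_B.+1})
  (E := fun v => E' (unbox v)) (g := fun v => h (unbox v))
  (fun v => mE' (unbox v)) (fun v v' w Ev Ev' => unbox_inj (disjE' Ev Ev')) mG Gb
  (fun v w => @GE' (unbox v) w).
under [X in `|_ - X|]eq_bigr do rewrite PE' /=.
under [X in _ <= _ * (_ - X)]eq_bigr do rewrite PE' /=.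
move=> /le_trans; apply; rewrite ler_wpM2l ?bound_ge0//.
have /andP[+ _] := cpois_field_box p_ge0 p_le1 mass_cvg sqr_mass_cvg0 B.
by rewrite !lerBlDr addrC.
Qed.

Let Kn n := \sum_i \sum_(j < k) j.+1%:R * block_mass (@lab n) (@p n) i j.

Lemma discrete_expectation_box n B :
  `|fine 'E_P[F n] - \sum_(v : {ffun I -> 'I_B.+1})
      h (unbox v) * block_pmf (@lab n) (@p n) (unbox v)| <= b * (Kn n / B.+1%:R).
Proof.
rewrite expectation_discreteE block_sum_box.
rewrite (bigID (fun x => [forall i, block_sum (@lab n) x i <= B]%N)) /= addrAC subrr add0r.
apply: le_trans (ler_norm_sum _ _ _) _.
apply: le_trans (_ : _ <= b * \sum_(x | ~~ [forall i, block_sum (@lab n) x i <= B]%N)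
    weight (@p n) x) _.
  rewrite big_distrr; apply: ler_sum => x _.
  by rewrite normrM (ger0_norm (weight_ge0 (@p_ge0 n) (@p_le1 n) x)) ler_wpM2r ?weight_ge0.
rewrite ler_wpM2l ?bound_ge0// ler_pdivlMr// mulrC.
exact: prob_outside_box.
Qed.

(** Three errors of size e/3: two from truncating to a box, and one from the convergence of a finite
    sum on that box. *)
Lemma expectation_block_cvg : fine 'E_P[F n] @[n --> \oo] --> fine 'E_P'[G].
Proof.
apply/cvgrPdistC_le => e e0.
have Kcvg : Kn n @[n --> \oo] --> K.
  apply: cvgr_sum => i _; apply: cvgr_sum => j _; exact: cvgMl_tmp.
have mu_ge0 i j : 0 <= mu i j.
  apply: (cvgr_to_ge (@mass_cvg i j)); apply: nearW => n.
  by apply: sumr_ge0 => c _; exact: p_ge0.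
have K0 : 0 <= K.
  by apply: sumr_ge0 => i _; apply: sumr_ge0 => j _; rewrite mulr_ge0.
have b0 := bound_ge0.
(* [K + 1] eventually bounds [Kn n] as well as [K], so one box serves the limit and all large
   [n]. *)
have [B BP] : exists B : nat, b * ((K + 1) / B.+1%:R) <= e / 3.
  exists (Num.truncn (b * (K + 1) / (e / 3))).
  rewrite mulrA ler_pdivrMr// [leRHS]mulrC -ler_pdivrMr ?divr_gt0//.
  exact/ltW/truncnS_gt.
have hcvg : \sum_(v : {ffun I -> 'I_B.+1})
      h (unbox v) * block_pmf (@lab n) (@p n) (unbox v) @[n --> \oo] -->
    \sum_(v : {ffun I -> 'I_B.+1}) h (unbox v) * cpois_field_pmf mu (unbox v).
  by apply: cvgr_sum => v _; apply: cvgMl_tmp; exact: block_pmf_cvg.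
have KK : K < K + 1 by rewrite ltrDl.
move/cvgrPdistC_le : hcvg => /(_ (e / 3) (divr_gt0 e0 (ltr0n _ 3))) hcvg.
apply: filterS2 hcvg (cvgr_le _ Kcvg _ KK) => n hn Kn1.
have le1 : b * (Kn n / B.+1%:R) <= e / 3.
  by apply: le_trans BP; rewrite ler_wpM2l// ler_wpM2r.
have le2 : b * (K / B.+1%:R) <= e / 3.
  by apply: le_trans BP; rewrite ler_wpM2l// ler_wpM2r// lerDl.
have d1 := le_trans (discrete_expectation_box n B) le1.
have d2 := le_trans (limit_expectation_box B) le2.
move: d1 d2 hn; set x := fine _; set y := fine _; set s := \sum_v _; set s' := \sum_v _.
move=> d1 d2 hn.
rewrite (_ : x - y = (x - s) + (s - s') + (s' - y)); last by ring.
apply: le_trans (ler_normD _ _) _; rewrite [in X in _ + X]distrC.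
apply: le_trans (lerD (le_trans (ler_normD _ _) (lerD d1 hn)) d2) _.
by lra.
Qed.

End ExpectationLimit.

Lemma finite_independence (R : realType) (d : measure_display)
    (T : measurableType d) (P : probability T R) (I : choiceType) (D : set I)
    (X : I -> T -> R) (C : finType) (phi : C -> I) (B : C -> set R) :
  mutually_independent P D X -> injective phi -> (forall c, D (phi c)) ->
  (forall c, measurable (B c)) ->
  P (\bigcap_c (X (phi c) @^-1` B c)) = (\prod_c P (X (phi c) @^-1` B c))%E.
Proof.
move=> indep phi_inj Dphi mB.
pose J := [fset phi c | c in [set: C]%SET]%fset.
(* Transports [B] along [phi]; the default [setT] only concerns indices outside the image [J]. *)
pose B' i := if [pick c | phi c == i] is Some c then B c else setT.
have B'phi c : B' (phi c) = B c.
  rewrite /B'; case: pickP => [c' /eqP/phi_inj-> //|/(_ c)]; by rewrite eqxx.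
have := indep J B'; rewrite big_imfset /=; last by move=> c c' _ _; exact: phi_inj.
rewrite (eq_bigr (fun c => P (X (phi c) @^-1` B c))); last by move=> c _; rewrite B'phi.
rewrite big_enum /= (eq_bigl xpredT); last by move=> c; rewrite inE.
move=> <-; last 2 first.
- by move=> _ /imfsetP[c _ ->]; exact: Dphi.
- by move=> _ /imfsetP[c _ ->]; rewrite B'phi.
congr (P _); apply/seteqP; split => [w Xw _ /imfsetP[c _ ->]|w Xw c _].
  by rewrite /= B'phi; exact: Xw.
by rewrite -B'phi; apply: Xw; apply/imfsetP; exists c; rewrite ?inE.
Qed.

(** * Increments over a grid *)

Section GPRFGrid.
Context (R : realType) (d : measure_display) (T : measurableType d).
Context (P : probability T R) (k : nat) (lambda : 'I_k -> R).
Variable M : R -> R -> {RV P >-> R}.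
Hypothesis hM : is_GPRF lambda M.
Variables (r r' : nat) (s t : nat -> R).
Hypotheses (s0 : s 0%N = 0) (t0 : t 0%N = 0).
Hypothesis homos : {homo s : a b / (a <= b)%N >-> a <= b}.
Hypothesis homot : {homo t : a b / (a <= b)%N >-> a <= b}.

Let I := ('I_r.+1 * 'I_r'.+1)%type.
Definition grid_lo (u : I) : R * R := (s u.1, t u.2).
Definition grid_hi (u : I) : R * R := (s u.1.+1, t u.2.+1).

Definition grid_mean (u : I) (j : 'I_k) : R :=
  lambda j * (s u.1.+1 - s u.1) * (t u.2.+1 - t u.2).

Definition grid_event (v : {ffun I -> nat}) : set T :=
  \bigcap_u (increment M (grid_lo u) (grid_hi u) @^-1` [set (v u)%:R]).

Lemma grid_preceq u : preceq (0, 0) (grid_lo u) /\ preceq (grid_lo u) (grid_hi u).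
Proof.
rewrite /preceq /=; split; split; try exact: homos; try exact: homot.
- by rewrite -s0; exact: homos.
- by rewrite -t0; exact: homot.
Qed.

(** If [a < b], then x <= S (a+1) <= S b < x, which is absurd; the case [b < a] is symmetric. *)
Lemma strip_unique (S : nat -> R) (a b : nat) x :
  {homo S : a b / (a <= b)%N >-> a <= b} ->
  S a < x <= S a.+1 -> S b < x <= S b.+1 -> a = b.
Proof.
move=> homoS /andP[xa1 xa2] /andP[xb1 xb2]; apply/eqP; rewrite eqn_leq.
apply/andP; split; rewrite leqNgt; apply/negP => ab.
  by have := lt_le_trans xa1 (le_trans xb2 (homoS _ _ ab)); rewrite ltxx.
by have := lt_le_trans xb1 (le_trans xa2 (homoS _ _ ab)); rewrite ltxx.
Qed.

Lemma grid_disjoint u u' x :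
  rectangle (grid_lo u) (grid_hi u) x -> rectangle (grid_lo u') (grid_hi u') x -> u = u'.
Proof.
case: u u' => [i j] [i' j'] [] /=; rewrite !in_itv /= => xi xj [] /=.
rewrite !in_itv /= => xi' xj'; congr (_, _); apply: val_inj => /=.
  exact: strip_unique homos xi xi'.
exact: strip_unique homot xj xj'.
Qed.

Lemma measurable_increment a b : measurable_fun setT (increment M a b).
Proof.
apply: measurable_funD => //; apply: measurable_funB => //.
exact: measurable_funB.
Qed.

Lemma measurable_grid_event v : measurable (grid_event v).
Proof.
apply: fin_bigcap_measurable => [|u _]; first exact: finite_finset.
rewrite -[X in measurable X]setTI.
exact: measurable_increment.
Qed.

Lemma grid_event_inj v v' w : grid_event v w -> grid_event v' w -> v = v'.
Proof.
move=> vw v'w; apply/ffunP => u; apply/eqP; rewrite -(eqr_nat R); apply/eqP.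
by rewrite -(vw u Logic.I) -(v'w u Logic.I).
Qed.

Lemma prob_grid_event v : P (grid_event v) = (cpois_field_pmf grid_mean v)%:E.
Proof.
(* [gprf_indep] takes families indexed by ordinals, so the grid is enumerated. *)
pose a (i : 'I_#|{: I}|) := grid_lo (enum_val i).
pose b (i : 'I_#|{: I}|) := grid_hi (enum_val i).
have indep : mutually_independent P setT (fun i => increment M (a i) (b i)).
  apply: (gprf_indep hM) => [i|]; first exact: grid_preceq.
  apply/trivIsetP => i i' _ _ ii'; apply/seteqP; split => // x [xi xi'].
  by move/eqP : ii'; apply; apply: enum_val_inj; exact: grid_disjoint xi xi'.
have rankE u : increment M (a (enum_rank u)) (b (enum_rank u)) =
    increment M (grid_lo u) (grid_hi u).
  by rewrite /a /b enum_rankK.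
have -> : grid_event v = \bigcap_u
    (increment M (a (enum_rank u)) (b (enum_rank u)) @^-1` [set (v u)%:R]).
  by apply: eq_bigcapr => u _; rewrite rankE.
have -> := finite_independence (B := fun u => [set (v u)%:R]) indep
  (@enum_rank_inj I) (fun=> Logic.I) (fun=> measurable_set1 _).
rewrite /cpois_field_pmf -prodEFin; apply: eq_bigr => u _; rewrite rankE.
have [lo0 lohi] := grid_preceq u.
by rewrite (gprf_law hM (v u) lo0 lohi) gprf_pmfE.
Qed.

(** The field vanishes on the axes almost surely for each time separately; restricting to the
    countably many grid times gives one common null set. *)
Definition anchored (w : T) : Prop :=
  forall q : nat, M 0 (t q) w = 0 /\ M (s q) 0 w = 0.

Lemma ae_anchored : {ae P, forall w, anchored w}.
Proof.
apply: ae_foralln => q.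
have sq : 0 <= s q by rewrite -s0; exact: homos.
have tq : 0 <= t q by rewrite -t0; exact: homot.
by apply: filterS2 (gprf_left hM tq) (gprf_bottom hM sq).
Qed.

Lemma anchored_grid_sum w (i : 'I_r.+1) (i' : 'I_r'.+1) : anchored w ->
  M (s i.+1) (t i'.+1) w =
  \sum_(u : I | (u.1 <= i)%N && (u.2 <= i')%N) increment M (grid_lo u) (grid_hi u) w.
Proof.
move=> anch; rewrite -(pair_big (fun u1 : 'I_r.+1 => (u1 <= i)%N)
  (fun u2 : 'I_r'.+1 => (u2 <= i')%N)
  (fun u1 u2 => increment M (grid_lo (u1, u2)) (grid_hi (u1, u2)) w)) /=.
pose D q q' := M (s q) (t q') w.
(* Telescoping in [u2] leaves differences in [u1], which telescope in turn; the boundary terms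
   vanish by [anchored]. *)
transitivity (\sum_(u1 < r.+1 | (u1 <= i)%N)
    ((D u1.+1 i'.+1 - D u1.+1 0%N) - (D u1 i'.+1 - D u1 0%N))); last first.
  apply: eq_bigr => u1 _; rewrite -!telescope_le -sumrB; apply: eq_bigr => u2 _.
  by rewrite /increment /D /=; ring.
rewrite (telescope_le (fun q => D q i'.+1 - D q 0%N)) /D s0 t0.
have := (anch 0%N).1; rewrite t0 => ->.
by rewrite (anch i'.+1).1 (anch i.+1).2; ring.
Qed.

End GPRFGrid.

(** * Application to the grid spanned by the given points *)

Lemma prob_setI_conull (R : realType) (d : measure_display) (T : measurableType d)
    (P : probability T R) (A N : set T) :
  measurable A -> measurable N -> P N = 0%E -> P (A `&` ~` N) = P A.
Proof.
move=> mA mN N0; rewrite -setDE measureD//; last first.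
  by rewrite -ge0_fin_numE// fin_num_measure.
rewrite [X in (_ - X)%E](_ : _ = 0%E) ?sube0//.
by apply/eqP; rewrite -measure_le0 -N0 le_measure// inE//; exact: measurableI.
Qed.

Lemma measurable_Ysum (R : realType) (d : measure_display) (T : measurableType d)
    (P : probability T R) (X : nat -> nat -> nat -> {RV P >-> R}) n s t :
  measurable_fun setT (Ysum X n s t).
Proof.
apply: measurable_sum => m; apply: measurable_sum => l; exact: measurable_funPT.
Qed.

Theorem proposition3p1 (R : realType)
    (k : nat) (hk : (1 <= k)%N)
    (lambda : 'I_k -> R) (hlambda : forall j, 0 < lambda j)
    (p : nat -> nat -> nat -> 'I_k -> R)
    (hp : forall n m l : nat, (1 <= n)%N -> (1 <= m)%N -> (1 <= l)%N ->
      forall j, 0 < p n m l j < 1)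
    (hpsum : forall n m l : nat, (1 <= n)%N -> (1 <= m)%N -> (1 <= l)%N ->
      \sum_(j < k) p n m l j < 1)
    (d : measure_display) (T : measurableType d) (P : probability T R)
    (X : nat -> nat -> nat -> {RV P >-> R})
    (hXindep : mutually_independent P
      [set i : nat * nat * nat |
        [/\ (1 <= i.1.1)%N, (1 <= i.1.2)%N & (1 <= i.2)%N]]
      (fun i => X i.1.1 i.1.2 i.2 : T -> R))
    (hXj : forall n m l : nat, (1 <= n)%N -> (1 <= m)%N -> (1 <= l)%N ->
      forall j : 'I_k, P [set w | X n m l w = j.+1%:R] = (p n m l j)%:E)
    (hX0 : forall n m l : nat, (1 <= n)%N -> (1 <= m)%N -> (1 <= l)%N ->
      P [set w | X n m l w = 0] = (1 - \sum_(j < k) p n m l j)%:E)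
    (hmax : forall j : 'I_k,
      \big[Num.max/0]_(1 <= m < n.+1) \big[Num.max/0]_(1 <= l < n.+1) p n m l j
        @[n --> \oo] --> (0 : R))
    (hsum : forall (j : 'I_k) (s t : R), 0 <= s -> 0 <= t ->
      \sum_(1 <= m < (Num.truncn (n%:R * s)).+1)
        \sum_(1 <= l < (Num.truncn (n%:R * t)).+1) p n m l j
        @[n --> \oo] --> lambda j * s * t)
    (d' : measure_display) (T' : measurableType d') (P' : probability T' R)
    (M : R -> R -> {RV P' >-> R}) (hM : is_GPRF lambda M)
    (r : nat) (hr : (1 <= r)%N) (z : 'I_r -> R * R)
    (hz0 : prec (0, 0) (z (Ordinal hr)))
    (hz : forall i j : 'I_r, (i <= j)%N -> preceq (z i) (z j)) :
  cvg_in_distribution P P'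
    (fun n w => \row_(i < r) Ysum X n (z i).1 (z i).2 w)
    (fun w => \row_(i < r) M (z i).1 (z i).2 w).
Proof.
case: r hr z hz0 hz => // r {}hr z hz0 hz.
(* Extends [z] to all naturals, constant from [r] on, which keeps it monotone. *)
pose zz q := z (inord (minn q r)).
have zE (i : 'I_r.+1) : z i = zz i.
  by rewrite /zz (minn_idPl _) ?inord_val// -ltnS.
(* A leading 0 shifts the coordinates by one: [z i] is the upper corner of block [(i, i)]. *)
pose S q := if q is q'.+1 then (zz q').1 else 0.
pose U q := if q is q'.+1 then (zz q').2 else 0.
have homozz a b : (a <= b)%N -> preceq (zz a) (zz b).
  move=> ab; apply: hz; rewrite !inordK ?ltnS ?geq_minr//.
  by rewrite leq_min geq_minr andbT (leq_trans (geq_minl _ _)).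
have zz0 a : 0 <= (zz a).1 /\ 0 <= (zz a).2.
  have [z1 z2] := hz (Ordinal hr) (inord (minn a r)) (leq0n _).
  by case: hz0 => /ltW/le_trans/(_ z1) h1 /ltW/le_trans/(_ z2) h2.
have homoS : {homo S : a b / (a <= b)%N >-> a <= b}.
  by case=> [|a] [|b]//= ab; [exact: (zz0 _).1 | exact: (proj1 (homozz a b ab))].
have homoU : {homo U : a b / (a <= b)%N >-> a <= b}.
  by case=> [|a] [|b]//= ab; [exact: (zz0 _).2 | exact: (proj2 (homozz a b ab))].
have S0 : S 0%N = 0 by []. have U0 : U 0%N = 0 by [].
have Sr0 : 0 <= S r.+1 by exact: (zz0 _).1.
have Ur0 : 0 <= U r.+1 by exact: (zz0 _).2.
have p0 n m l j : (1 <= n)%N -> (1 <= m)%N -> (1 <= l)%N -> 0 <= p n m l j.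
  by move=> n0 m0 l0; have /andP[/ltW] := hp n m l n0 m0 l0 j.
pose C := cells (S r.+1) (U r.+1).
pose pc n : C n -> 'I_k -> R := @cell_prob R k p (S r.+1) (U r.+1) n.
pose lab n : C n -> 'I_r.+1 * 'I_r.+1 := @cell_strips R (S r.+1) (U r.+1) S U r r n.
have pc0 n c j : 0 <= @pc n c j by exact: cell_prob_ge0.
have pc1 n c : cell_mass (@pc n) c <= 1.
  by apply/ltW/hpsum => //; exact: cells_gt0 c.
pose mu := @grid_mean R k lambda r r S U.
have pc_cvg i j : block_mass (@lab n) (@pc n) i j @[n --> \oo] --> mu i j.
  exact: block_mass_strips_cvg.
have pc_sqr : \sum_(c : C n) cell_mass (@pc n) c ^+ 2 @[n --> \oo] --> (0 : R).
  exact: (sqr_cell_mass_cvg0 hsum p0).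
move=> f cf [b fb].
(* The value at [z i] recovered from the blocks to its lower left. *)
pose g (v : {ffun 'I_r.+1 * 'I_r.+1 -> nat}) (i : 'I_r.+1) : R :=
  (\sum_(u : 'I_r.+1 * 'I_r.+1 | (u.1 <= i) && (u.2 <= i)) v u)%N%:R.
pose h v : R := f (\row_i g v i).
pose E n (x : {ffun C n -> 'I_k.+1}) : set T :=
  \bigcap_(c : C n) (X n c.1.+1 c.2.+1 @^-1` [set (x c : nat)%:R]).
have mE n x : measurable (@E n x).
  apply: fin_bigcap_measurable => [|c _]; first exact: finite_finset.
  by rewrite -[X in measurable X]setTI; exact: measurable_funPT.
have disjE n (x x' : {ffun C n -> 'I_k.+1}) w : E n x w -> E n x' w -> x = x'.
  move=> xw x'w; apply/ffunP => c; apply/val_inj/eqP; rewrite -(eqr_nat R); apply/eqP.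
  by rewrite -(xw c Logic.I) -(x'w c Logic.I).
have PE n x : P (@E n x) = (weight (@pc n) x)%:E.
  pose phi (c : C n) := (n, c.1.+1, c.2.+1).
  have phi_inj : injective phi.
    by move=> [c1 c2] [c1' c2'] [/val_inj-> /val_inj->].
  have := @finite_independence _ _ _ _ _ _ _ (C n) phi (fun c => [set (x c : nat)%:R])
    hXindep phi_inj.
  move=> -> //; last by move=> c; split => //; exact: cells_gt0 c.
  rewrite /weight -prodEFin; apply: eq_bigr => c _ /=.
  rewrite /cell_pmf; case: unliftP => [j ->|->].
    exact: (hXj n c.1.+1 c.2.+1 (cells_gt0 c) isT isT j).
  exact: (hX0 n c.1.+1 c.2.+1 (cells_gt0 c) isT isT).
have FE n (x : {ffun C n -> 'I_k.+1}) w : E n x w ->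
    f (\row_i Ysum X n (z i).1 (z i).2 w) = h (block_sum (@lab n) x).
  move=> xw; congr f; apply/rowP => i; rewrite !mxE zE.
  have hS := homo_scaled n homoS; have hU := homo_scaled n homoU.
  rewrite /Ysum (@sum_cells _ (scaled S n r.+1) (scaled U n r.+1) (scaled S n i.+1)
    (scaled U n i.+1) (fun m l => X n m l w)); [|exact: hS|exact: hU].
  rewrite (eq_bigr (fun c => (x c : nat)%:R)) => [|c _]; last exact: (xw c Logic.I).
  rewrite -natr_sum (sum_strips (fun c => x c : nat) i i hS hU) /g; congr _%:R.
  by apply: eq_bigr => u _; rewrite ffunE.
have [N [mN N0 anchN]] := ae_anchored hM S0 U0 homoS homoU.
(* Removing the null set [N] makes the decomposition of [M] into increments hold at every point of
   [E' v], without changing its probability. *)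
pose E' (v : {ffun 'I_r.+1 * 'I_r.+1 -> nat}) := grid_event M S U v `&` ~` N.
have mE' v : measurable (E' v).
  by apply: measurableI; [exact: measurable_grid_event | exact: measurableC].
have disjE' v v' w : E' v w -> E' v' w -> v = v'.
  by move=> [vw _] [v'w _]; exact: grid_event_inj vw v'w.
have PE' v : P' (E' v) = (cpois_field_pmf mu v)%:E.
  rewrite prob_setI_conull//; first exact: prob_grid_event.
  exact: measurable_grid_event.
have GE' v w : E' v w -> f (\row_i M (z i).1 (z i).2 w) = h v.
  move=> [vw Nw]; congr f; apply/rowP => i; rewrite !mxE zE.
  have anch : anchored M S U w by apply: contrapT => nw; exact/Nw/anchN.
  rewrite (@anchored_grid_sum _ _ _ _ M r r S U S0 U0 w i i anch) /g natr_sum.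
  by apply: eq_bigr => u _; exact: vw.
have mF n : measurable_fun setT (fun w => f (\row_i Ysum X n (z i).1 (z i).2 w)).
  by apply: measurable_continuous_row => // i; exact: measurable_Ysum.
have mG : measurable_fun setT (fun w => f (\row_i M (z i).1 (z i).2 w)).
  by apply: measurable_continuous_row => // i; exact: measurable_funPT.
have := expectation_block_cvg (P := P) (P' := P') pc0 pc1 pc_cvg pc_sqr mF mG
  (fun n w => fb _) (fun w => fb _) (fun v => fb _) mE disjE PE FE mE' disjE' PE' GE'.
rewrite -[X in _ -> _ --> X]fineK; last exact: bounded_expectation_fin_num mG (fun w => fb _).
move=> EFG; apply: cvg_EFin => //; apply: nearW => n.
exact: bounded_expectation_fin_num (mF n) (fun w => fb _).
Qed.
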